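(* Let $(M,H,G)$ be a quaternionic Kähler NH-manifold with associated local 1-forms $\omega_1,\omega_2,\omega_3$, and let $\Omega_1,\Omega_2,\Omega_3$ be the vector fields corresponding to them with respect to $g$, i.e. $\omega_\alpha(x)=g(x,\Omega_\alpha)$. Then $(M,H,G)$ is an isotropic hyper-Kähler NH-manifold if and only if $g(\Omega_\alpha,\Omega_\alpha)=0$ for $\alpha=1,2,3$.
   Context: $M$ is a smooth manifold of dimension $4n$. An almost hypercomplex structure on $M$ is a triple $H=(J_1,J_2,J_3)$ of almost complex structures with $J_\alpha=J_\beta\circ J_\gamma=-J_\gamma\circ J_\beta$ and $J_\alpha^2=-I$ for all cyclic permutations $(\alpha,\beta,\gamma)$ of $(1,2,3)$. Put $\varepsilon_1=1$, $\varepsilon_2=\varepsilon_3=-1$. An NH-metric structure $G=(g,g_1,g_2,g_3)$ on $(M,H)$ consists of a pseudo-Riemannian metric $g$ of neutral signature $(2n,2n)$ with $g(x,y)=\varepsilon_\alpha g(J_\alpha x,J_\alpha y)$ for $\alpha=1,2,3$, together with $g_\alpha(x,y)=g(J_\alpha x,y)=-\varepsilon_\alpha g(x,J_\alpha y)$. $(M,H,G)$ is then an almost hypercomplex NH-manifold. Let $\nabla$ be the Levi-Civita connection of $g$. $(M,H,G)$ is a quaternionic Kähler NH-manifold if there are (local) 1-forms $\omega_1,\omega_2,\omega_3$ with $(\nabla_xJ_\alpha)y=\omega_\gamma(x)J_\beta y-\omega_\beta(x)J_\gamma y$ for all cyclic permutations $(\alpha,\beta,\gamma)$ of $(1,2,3)$.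 The square norm of $\nabla J_\alpha$ is $\|\nabla J_\alpha\|^2=g^{ij}g^{kl}g((\nabla_{e_i}J_\alpha)e_k,(\nabla_{e_j}J_\alpha)e_l)$ for a basis $\{e_i\}$ of the tangent space. An almost hypercomplex NH-manifold is an isotropic hyper-Kähler NH-manifold if $\|\nabla J_\alpha\|^2=0$ for $\alpha=1,2,3$. *)

(* Defs.v *)
From HB Require Import structures.
From mathcomp Require Import all_boot all_order all_algebra.
From mathcomp Require Import all_classical all_reals all_analysis.
Set Implicit Arguments.
Unset Strict Implicit.
Unset Printing Implicit Defensive.
Import Order.TTheory GRing.Theory Num.Theory numFieldNormedType.Exports.
Local Open Scope classical_set_scope.
Local Open Scope ring_scope.

Definition iter_partial (R : realType) (m : nat) (s : seq 'I_m)
    (f : 'rV[R]_m -> R) : 'rV[R]_m -> R :=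
  foldr (fun a h x => 'D_(delta_mx 0 a) h x) f s.

(* For an open [D] this is C^oo: if all iterated partial derivatives are
   differentiable, they are in particular continuous; the converse is the
   usual "C^1 implies differentiable". *)
Definition smooth_on (R : realType) (m : nat) (D : set 'rV[R]_m)
    (f : 'rV[R]_m -> R) : Prop :=
  forall (s : seq 'I_m) (x : 'rV[R]_m), D x ->
    differentiable (iter_partial s f) x.

Definition smooth_mx_on (R : realType) (m k l : nat) (D : set 'rV[R]_m)
    (F : 'rV[R]_m -> 'M[R]_(k, l)) : Prop :=
  forall a b, smooth_on D (fun x => F x a b).

(* [chart_at] selects a chart around every point.  It is only a bookkeeping
   device (see the tangent spaces below) and no regularity is asked of it.
   Charts and their inverses are total functions, meaningful only on
   [chart_dom i] and on its image. *)
Record smooth_manifold (R : realType) (m : nat) := SmoothManifold {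
  carrier :> topologicalType;
  carrier_hausdorff : hausdorff_space carrier;
  carrier_second_countable : @second_countable carrier;
  chart_index : Type;
  chart_dom : chart_index -> set carrier;
  chart : chart_index -> carrier -> 'rV[R]_m;
  chart_inv : chart_index -> 'rV[R]_m -> carrier;
  chart_dom_open : forall i, open (chart_dom i);
  chart_img_open : forall i, open (chart i @` chart_dom i);
  chartK : forall i p, chart_dom i p -> chart_inv i (chart i p) = p;
  chart_continuous : forall i, {within chart_dom i, continuous (chart i)};
  chart_inv_continuous :
    forall i, {within chart i @` chart_dom i, continuous (chart_inv i)};
  transition_smooth : forall i j,
    smooth_mx_on (chart i @` (chart_dom i `&` chart_dom j))
                 (chart j \o chart_inv i);
  chart_at : carrier -> chart_index;
  chart_at_dom : forall p, chart_dom (chart_at p) p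
}.

Section Tensors.
Context {R : realType} {m : nat} {M : smooth_manifold R m}.
Implicit Types (p q : M) (U : set M).

(* The tangent space at [p] is represented by ['rV[R]_m]: a tangent vector is
   given by its components in the chart [chart_at p].  [coord_mx i q] is the
   change of basis to the components in the chart [i] (acting on row vectors),
   and the rows of [frame_mx i q] are the coordinate vectors d/dx^1, ...,
   d/dx^m of the chart [i] at [q]; the two are mutually inverse for [q] in
   [chart_dom i]. *)
Definition coord_mx (i : chart_index M) q : 'M[R]_m :=
  jacobian (chart i \o chart_inv (chart_at q)) (chart (chart_at q) q).

Definition frame_mx (i : chart_index M) q : 'M[R]_m :=
  jacobian (chart (chart_at q) \o chart_inv i) (chart i q).

(* Tensor fields are smooth when their components in every chart are.
   Vector fields take values in row vectors, 1-forms in column vectors,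
   (1,1)-tensors in matrices acting on row vectors from the right, and
   (0,2)-tensors in Gram matrices.  A field is defined everywhere, but is only
   meaningful on the open set under consideration. *)
Definition smooth_fun U (f : M -> R) : Prop :=
  forall i, smooth_on (chart i @` (U `&` chart_dom i)) (f \o chart_inv i).

Definition smooth_field U (X : M -> 'rV[R]_m) : Prop :=
  forall i, smooth_mx_on (chart i @` (U `&` chart_dom i))
    ((fun q => X q *m coord_mx i q) \o chart_inv i).

Definition smooth_form U (w : M -> 'cV[R]_m) : Prop :=
  forall i, smooth_mx_on (chart i @` (U `&` chart_dom i))
    ((fun q => frame_mx i q *m w q) \o chart_inv i).

Definition smooth_endo U (J : M -> 'M[R]_m) : Prop :=
  forall i, smooth_mx_on (chart i @` (U `&` chart_dom i))
    ((fun q => frame_mx i q *m J q *m coord_mx i q) \o chart_inv i).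

Definition smooth_bilin U (g : M -> 'M[R]_m) : Prop :=
  forall i, smooth_mx_on (chart i @` (U `&` chart_dom i))
    ((fun q => frame_mx i q *m g q *m (frame_mx i q)^T) \o chart_inv i).

Definition smooth_fun_near p (f : M -> R) : Prop :=
  exists U, [/\ open U, U p & smooth_fun U f].

Definition smooth_field_near p (X : M -> 'rV[R]_m) : Prop :=
  exists U, [/\ open U, U p & smooth_field U X].

Definition form_app (w : M -> 'cV[R]_m) p (v : 'rV[R]_m) : R :=
  (v *m w p) 0 0.

Definition endo_app (J : M -> 'M[R]_m) p (v : 'rV[R]_m) : 'rV[R]_m :=
  v *m J p.

Definition bilin_app (g : M -> 'M[R]_m) p (u v : 'rV[R]_m) : R :=
  (u *m g p *m v^T) 0 0.

Definition dfun (f : M -> R) p (v : 'rV[R]_m) : R :=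
  'D_v (f \o chart_inv (chart_at p)) (chart (chart_at p) p).

End Tensors.

(* [nabla D p v Y] is the covariant derivative at [p] of the vector field [Y]
   in the direction of the tangent vector [v]; it is only meaningful for [Y]
   smooth near [p].  It depends only on the germ of [Y] at [p]: apply
   [nabla_leibniz] to the indicator function of the complement of a
   neighbourhood of [p], which is smooth near [p]. *)
Record connection (R : realType) (m : nat) (M : smooth_manifold R m) :=
  Connection {
  nabla : forall p : M, 'rV[R]_m -> (M -> 'rV[R]_m) -> 'rV[R]_m;
  nabla_linear : forall (p : M) (Y : M -> 'rV[R]_m), smooth_field_near p Y ->
    forall (a : R) (u v : 'rV[R]_m),
      nabla p (a *: u + v) Y = a *: nabla p u Y + nabla p v Y;
  nabla_add : forall (p : M) (Y Z : M -> 'rV[R]_m) (v : 'rV[R]_m),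
    smooth_field_near p Y -> smooth_field_near p Z ->
    nabla p v (fun q => Y q + Z q) = nabla p v Y + nabla p v Z;
  nabla_leibniz : forall (p : M) (f : M -> R) (Y : M -> 'rV[R]_m)
      (v : 'rV[R]_m),
    smooth_fun_near p f -> smooth_field_near p Y ->
    nabla p v (fun q => f q *: Y q) = dfun f p v *: Y p + f p *: nabla p v Y;
  nabla_smooth : forall (U : set M) (X Y : M -> 'rV[R]_m), open U ->
    smooth_field U X -> smooth_field U Y ->
    smooth_field U (fun q => nabla q (X q) Y)
}.

Section LeviCivita.
Context {R : realType} {m : nat} {M : smooth_manifold R m}.

(* The bracket is the commutator of derivations: [X,Y] f = X(Y f) - Y(X f). *)
Definition torsion_free (D : connection M) : Prop :=
  forall (p : M) (X Y : M -> 'rV[R]_m) (f : M -> R),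
    smooth_field_near p X -> smooth_field_near p Y -> smooth_fun_near p f ->
    dfun f p (nabla D p (X p) Y - nabla D p (Y p) X) =
    dfun (fun q => dfun f q (Y q)) p (X p)
    - dfun (fun q => dfun f q (X q)) p (Y p).

Definition metric_connection (g : M -> 'M[R]_m) (D : connection M) : Prop :=
  forall (p : M) (v : 'rV[R]_m) (Y Z : M -> 'rV[R]_m),
    smooth_field_near p Y -> smooth_field_near p Z ->
    dfun (fun q => bilin_app g q (Y q) (Z q)) p v =
    bilin_app g p (nabla D p v Y) (Z p) + bilin_app g p (Y p) (nabla D p v Z).

Definition levi_civita (g : M -> 'M[R]_m) (D : connection M) : Prop :=
  torsion_free D /\ metric_connection g D.

(* The vector field with constant components in the chart [chart_at p] and
   value [w] at [p]. *)
Definition extend (p : M) (w : 'rV[R]_m) : M -> 'rV[R]_m :=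
  fun q => w *m frame_mx (chart_at p) q.

(* (nabla_v J) w = nabla_v (J W) - J (nabla_v W) for any vector field [W] near
   [p] extending [w]; by the Leibniz rule the result does not depend on the
   extension. *)
Definition nabla_endo (D : connection M) (J : M -> 'M[R]_m) (p : M)
    (v w : 'rV[R]_m) : 'rV[R]_m :=
  nabla D p v (fun q => endo_app J q (extend p w q))
  - endo_app J p (nabla D p v (extend p w)).

(* [g^ij g^kl g((nabla_{e_i} J) e_k, (nabla_{e_j} J) e_l)] where the vectors of
   the basis [e] of the tangent space at [p] are the rows of [E]. *)
Definition nabla_endo_sqnorm (D : connection M) (g J : M -> 'M[R]_m) (p : M)
    (E : 'M[R]_m) : R :=
  let ginv := invmx (\matrix_(i, j) bilin_app g p (row i E) (row j E)) in
  \sum_i \sum_j \sum_k \sum_l ginv i j * ginv k l *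
    bilin_app g p (nabla_endo D J p (row i E) (row k E))
                  (nabla_endo D J p (row j E) (row l E)).

End LeviCivita.

(* The indices 1, 2, 3 are 0, 1, 2 : 'I_3, and the cyclic permutations of
   (1,2,3) are the triples (a, ordS a, ordS (ordS a)). *)
Definition eps (R : realType) (a : 'I_3) : R := if a == ord0 then 1 else -1.

Record hypercomplex (R : realType) (m : nat) (M : smooth_manifold R m) :=
  Hypercomplex {
  hcJ :> 'I_3 -> M -> 'M[R]_m;
  hcJ_smooth : forall a, smooth_endo setT (hcJ a);
  hcJ_sqr : forall a p v,
    endo_app (hcJ a) p (endo_app (hcJ a) p v) = - v;
  hcJ_mul : forall a p v,
    endo_app (hcJ a) p v =
    endo_app (hcJ (ordS a)) p (endo_app (hcJ (ordS (ordS a))) p v);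
  hcJ_anti : forall a p v,
    endo_app (hcJ a) p v =
    - endo_app (hcJ (ordS (ordS a))) p (endo_app (hcJ (ordS a)) p v)
}.

(* [B] is symmetric of signature (k, m - k): in a suitable basis (the rows of
   [P]) it is diag(1, ..., 1, -1, ..., -1) with [k] entries 1. *)
Definition has_signature (R : realType) (m k : nat) (B : 'M[R]_m) : Prop :=
  B^T = B /\ exists2 P : 'M[R]_m, P \in unitmx &
    P *m B *m P^T = diag_mx (\row_(i < m) if (i < k)%N then 1 else -1).

Record nh_metric (R : realType) (n : nat) (M : smooth_manifold R (4 * n))
    (H : hypercomplex M) := NHMetric {
  nhg :> M -> 'M[R]_(4 * n);
  nhg_smooth : smooth_bilin setT nhg;
  nhg_neutral : forall p, has_signature (2 * n) (nhg p);
  nhg_compat : forall a p x y,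
    bilin_app nhg p x y =
    eps R a * bilin_app nhg p (endo_app (H a) p x) (endo_app (H a) p y);
  nhg_assoc : 'I_3 -> M -> 'M[R]_(4 * n);
  nhg_assocE : forall a p x y,
    bilin_app (nhg_assoc a) p x y = bilin_app nhg p (endo_app (H a) p x) y;
  nhg_assocE' : forall a p x y,
    bilin_app (nhg_assoc a) p x y =
    - eps R a * bilin_app nhg p x (endo_app (H a) p y)
}.

(* Local 1-forms [w l a] on the members [U l] of an open cover of [M] (for
   every [l], the values of [w l a] outside [U l] are irrelevant) for which
   (nabla_x J_a) y = w_c(x) J_b y - w_b(x) J_c y. *)
Definition quaternionic_kahler_forms (R : realType) (m : nat)
    (M : smooth_manifold R m) (H : hypercomplex M) (D : connection M)
    (L : Type) (U : L -> set M) (w : L -> 'I_3 -> M -> 'cV[R]_m) : Prop :=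
  [/\ forall l, open (U l),
      forall p, exists l, U l p,
      forall l a, smooth_form (U l) (w l a) &
      forall l a p, U l p -> forall x y,
        nabla_endo D (H a) p x y =
          form_app (w l (ordS (ordS a))) p x *: endo_app (H (ordS a)) p y
          - form_app (w l (ordS a)) p x *: endo_app (H (ordS (ordS a))) p y].

(* The square norm does not depend on the basis [E] in which it is written. *)
Definition isotropic_hyper_kahler (R : realType) (n : nat)
    (M : smooth_manifold R (4 * n)) (H : hypercomplex M) (G : nh_metric H)
    (D : connection M) : Prop :=
  forall (a : 'I_3) (p : M) (E : 'M[R]_(4 * n)), E \in unitmx ->
    nabla_endo_sqnorm D G (H a) p E = 0.

(* Main.v *)
Require Import Defs.
From mathcomp Require Import all_boot all_order all_algebra.
From mathcomp Require Import all_classical all_reals all_analysis.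
From mathcomp Require Import ring lra.
Set Implicit Arguments.
Unset Strict Implicit.
Unset Printing Implicit Defensive.
Import Order.TTheory GRing.Theory Num.Theory numFieldNormedType.Exports.
Local Open Scope classical_set_scope.
Local Open Scope ring_scope.

(** The equivalence is pointwise linear algebra.  Fix [p] in [U l], let
    (a, b, c) be a cyclic permutation, and let m = 4n be the dimension.
    Substituting the quaternionic Kaehler formula into the square norm of
    nabla J_a splits it into products of two metric traces, one over the
    direction of differentiation and one over the argument:
    - g^ij w_c(e_i) w_c(e_j) = g(Omega_c, Omega_c), because w_c is dual to
      Omega_c ([metric_trace_dual]);
    - g^kl g(J_b e_k, J_b e_l) = m eps_b, because J_b is an isometry or an
      anti-isometry ([metric_trace_isometry]);
    - g^kl g(J_b e_k, J_c e_l) = 0, because this is up to sign the trace of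
      J_b J_c, and anticommuting maps have a traceless product
      ([metric_trace_cross]).
    Hence ([sqnorm_nabla_endoE])
      |nabla J_a|^2 = m (eps_b g(Omega_c, Omega_c) + eps_c g(Omega_b, Omega_b)).
    With eps = (1, -1, -1) the vanishing of these three numbers says, for
    m > 0, that the squares of Omega_1, Omega_2 and Omega_3 are all equal and
    that those of Omega_2 and Omega_3 are opposite, so that all vanish.  For
    m = 0 every tangent vector is zero. *)

(** * Metric traces *)

Section MetricTrace.
Context {R : realType} {m : nat}.
Implicit Types (B C E J K S T : 'M[R]_m) (u v : 'rV[R]_m).

Lemma bilin_inj S T :
  (forall u v, (u *m S *m v^T) 0 0 = (u *m T *m v^T) 0 0) -> S = T.
Proof.
have entry (A : 'M[R]_m) i j :
    ((delta_mx 0 i : 'rV_m) *m A *m (delta_mx 0 j : 'rV_m)^T) 0 0 = A i j.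
  by rewrite trmx_delta -rowE -colE !mxE.
by move=> eqST; apply/matrixP => i j; rewrite -!entry.
Qed.

Lemma mulmx_inj S T : (forall v, v *m S = v *m T) -> S = T.
Proof. by move=> eqST; apply/row_matrixP => i; rewrite !rowE. Qed.

Lemma signature_unitmx k B : has_signature k B -> B \in unitmx.
Proof.
case=> _ [P Pu PBP].
have : P *m B *m P^T \in unitmx.
  rewrite PBP unitmxE det_diag unitfE prodf_seq_neq0; apply/allP => i _ /=.
  by rewrite mxE; case: ifP; rewrite ?oppr_eq0 oner_eq0.
by rewrite !unitmx_mul => /andP[/andP[]].
Qed.

(** The transpose makes this the entrywise pairing of [C] and [S], which is
    the contraction C^ij S_ij. *)
Definition contract C S : R := \tr (C *m S^T).

Lemma contractE C S : contract C S = \sum_i \sum_j C i j * S i j.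
Proof.
apply: eq_bigr => i _; rewrite mxE.
by apply: eq_bigr => j _; rewrite mxE.
Qed.

(** This is what separates, in the square norm, the contraction over the
    direction of differentiation from the one over the argument. *)
Lemma contract_tensor C S T :
  \sum_i \sum_j \sum_k \sum_l C i j * C k l * (S i j * T k l) =
  contract C S * contract C T.
Proof.
rewrite !contractE mulr_suml; apply: eq_bigr => i _.
rewrite mulr_suml; apply: eq_bigr => j _.
rewrite mulr_sumr; apply: eq_bigr => k _.
rewrite mulr_sumr; apply: eq_bigr => l _.
by ring.
Qed.

(** The change-of-basis factors cancel under the trace, so that it is enough
    to compute contractions in the standard basis. *)
Lemma contract_basis B E S : B \in unitmx -> E \in unitmx ->
  contract (invmx (E *m B *m E^T)) (E *m S *m E^T) = contract (invmx B) S.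
Proof.
move=> Bu Eu; have ETu : E^T \in unitmx by rewrite unitmx_tr.
have -> : invmx (E *m B *m E^T) = invmx E^T *m invmx B *m invmx E.
  have EBEu : E *m B *m E^T \in unitmx by rewrite !unitmx_mul Bu Eu ETu.
  apply: (can_inj (mulKmx EBEu)); rewrite mulmxV // !mulmxA.
  by rewrite mulmxK // mulmxK // mulmxV.
rewrite /contract !trmx_mul trmxK -!mulmxA (mulmxA (invmx E)) mulVmx //.
by rewrite mul1mx mxtrace_mulC -!mulmxA mulmxV // mulmx1.
Qed.

(** The map [J] pulls the metric back to [e] times itself, and
    the contraction of the metric with its inverse is the dimension. *)
Lemma metric_trace_isometry B J e : B^T = B -> B \in unitmx ->
  J *m B *m J^T = e *: B -> contract (invmx B) (J *m B *m J^T) = e * m%:R.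
Proof.
move=> Bsym Bu ->; rewrite /contract linearZ /= Bsym -scalemxAr mulVmx //.
by rewrite linearZ /= mxtrace1.
Qed.

(** Moving [K] across the metric turns this contraction into a multiple of the
    trace of [J *m K], and \tr (J *m K) = - \tr (K *m J) = - \tr (J *m K). *)
Lemma metric_trace_cross B J K e : B^T = B -> B \in unitmx ->
  K *m K = - 1%:M -> K *m B *m K^T = e *: B -> J *m K = - (K *m J) ->
  contract (invmx B) (J *m B *m K^T) = 0.
Proof.
move=> Bsym Bu K2 KB JK.
(* By K^-1 = - K. *)
have BKT : B *m K^T = - e *: (K *m B).
  rewrite scaleNr scalemxAr -KB !mulmxA K2 mulNmx mul1mx mulNmx.
  by rewrite opprK.
have trJK : \tr (J *m K) = 0.
  apply/eqP; rewrite -[_ == 0](mulrn_eq0 _ 2) mulr2n {1}JK linearN /=.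
  by rewrite mxtrace_mulC addNr.
rewrite /contract -mulmxA BKT -scalemxAr linearZ /= !mulmxA trmx_mul Bsym.
by rewrite -scalemxAr linearZ /= mulmxA mulVmx // mul1mx mxtrace_tr trJK mulr0.
Qed.

(** [B *m u^T] and [B *m v^T] are the 1-forms that the metric makes dual to [u]
    and [v]; contracted with the inverse metric they give the product of [u]
    and [v]. *)
Lemma metric_trace_dual B u v : B^T = B -> B \in unitmx ->
  contract (invmx B) ((B *m u^T) *m (B *m v^T)^T) = (u *m B *m v^T) 0 0.
Proof.
move=> Bsym Bu; rewrite /contract trmx_mul trmxK -!mulmxA mulKmx //.
by rewrite mxtrace_mulC trmx_mul trmxK Bsym /mxtrace big_ord1 mulmxA.
Qed.

Lemma gram_entry E S i j :
  (row i E *m S *m (row j E)^T) 0 0 = (E *m S *m E^T) i j.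
Proof.
by rewrite -row_mul !mxE; apply: eq_bigr => k _; rewrite !mxE.
Qed.

Lemma form_entry E (w z : 'cV[R]_m) i j :
  (row i E *m w) 0 0 * (row j E *m z) 0 0 = (E *m (w *m z^T) *m E^T) i j.
Proof.
rewrite -gram_entry !mulmxA -mulmxA -trmx_mul.
by rewrite [RHS]mxE big_ord1 [_^T _ _]mxE.
Qed.

(** The square norm of a bilinear map of the shape of nabla J_a in the
    quaternionic Kaehler condition.  Of the four products in the expansion of
    the square only those of like terms survive the contraction over the
    argument. *)
Lemma sqnorm_quaternionic B E J K (w z : 'cV[R]_m) u v d e :
    B^T = B -> B \in unitmx -> E \in unitmx ->
    J *m J = - 1%:M -> K *m K = - 1%:M -> J *m K = - (K *m J) ->
    J *m B *m J^T = d *: B -> K *m B *m K^T = e *: B ->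
    w = B *m u^T -> z = B *m v^T ->
  let nab (x y : 'rV[R]_m) :=
    (x *m w) 0 0 *: (y *m J) - (x *m z) 0 0 *: (y *m K) in
  let ginv := invmx (E *m B *m E^T) in
  \sum_i \sum_j \sum_k \sum_l ginv i j * ginv k l *
    (nab (row i E) (row k E) *m B *m (nab (row j E) (row l E))^T) 0 0 =
  m%:R * (d * (u *m B *m u^T) 0 0 + e * (v *m B *m v^T) 0 0).
Proof.
move=> Bsym Bu Eu J2 K2 JK JB KB wE zE nab ginv.
pose form (s t : 'cV[R]_m) := E *m (s *m t^T) *m E^T.
pose gram S T := E *m (S *m B *m T^T) *m E^T.
have expand i j k l :
    (nab (row i E) (row k E) *m B *m (nab (row j E) (row l E))^T) 0 0 =
    form w w i j * gram J J k l - form w z i j * gram J K k l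
    - form z w i j * gram K J k l + form z z i j * gram K K k l.
  rewrite /form /gram -!form_entry -!gram_entry /nab.
  move: ((row i E *m w) 0 0) ((row i E *m z) 0 0) => a b.
  move: ((row j E *m w) 0 0) ((row j E *m z) 0 0) => a' b'.
  have assoc S T : row k E *m (S *m B *m T^T) *m (row l E)^T =
      row k E *m S *m B *m (row l E *m T)^T.
    by rewrite trmx_mul !mulmxA.
  rewrite !assoc [(_ - _)^T]linearB /= ![(_ *: _)^T]linearZ /=.
  rewrite mulmxBr !mulmxBl -!scalemxAr -!scalemxAl.
  by rewrite !mxE; ring.
have crossJK := metric_trace_cross Bsym Bu K2 KB JK.
have crossKJ : contract (invmx B) (K *m B *m J^T) = 0.
  by apply: (metric_trace_cross Bsym Bu J2 JB); rewrite JK opprK.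
transitivity (contract ginv (form w w) * contract ginv (gram J J)
    - contract ginv (form w z) * contract ginv (gram J K)
    - contract ginv (form z w) * contract ginv (gram K J)
    + contract ginv (form z z) * contract ginv (gram K K)).
  rewrite -!contract_tensor -!sumrB -big_split /=; apply: eq_bigr => i _.
  rewrite -!sumrB -big_split /=; apply: eq_bigr => j _.
  rewrite -!sumrB -big_split /=; apply: eq_bigr => k _.
  rewrite -!sumrB -big_split /=; apply: eq_bigr => l _.
  by rewrite expand; ring.
rewrite !contract_basis // crossJK crossKJ wE zE !metric_trace_dual //.
rewrite (metric_trace_isometry Bsym Bu JB) (metric_trace_isometry Bsym Bu KB).
by ring.
Qed.

End MetricTrace.

(** * The square norm on a quaternionic Kaehler manifold *)

Section QuaternionicKaehler.
Context {R : realType} {n : nat} {M : smooth_manifold R (4 * n)}.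
Context {H : hypercomplex M}.
Implicit Types (G : nh_metric H) (p : M) (a : 'I_3).

Lemma hcJ_sqr_mx a p : H a p *m H a p = - 1%:M.
Proof.
apply: mulmx_inj => v; rewrite mulmxA mulmxN mulmx1.
exact: (hcJ_sqr H a p v).
Qed.

Lemma hcJ_anti_mx a p :
  H (ordS a) p *m H (ordS (ordS a)) p = - (H (ordS (ordS a)) p *m H (ordS a) p).
Proof.
apply: mulmx_inj => v; rewrite mulmxN !mulmxA.
rewrite -[LHS]opprK; congr (- _).
rewrite -[LHS](hcJ_anti H a p v); exact: (hcJ_mul H a p v).
Qed.

(** The sign can be moved to the other side because it squares to 1. *)
Lemma nhg_compat_mx G a p : H a p *m G p *m (H a p)^T = eps R a *: G p.
Proof.
have eps2 : eps R a * eps R a = 1.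
  by rewrite /eps; case: ifP; rewrite ?mulrNN mulr1.
have {2}-> : G p = eps R a *: (H a p *m G p *m (H a p)^T).
  apply: bilin_inj => u v; rewrite -[LHS]/(bilin_app G p u v).
  rewrite (nhg_compat G a p u v) /bilin_app /endo_app trmx_mul.
  by rewrite -scalemxAr -scalemxAl [in RHS]mxE !mulmxA.
by rewrite scalerA eps2 scale1r.
Qed.

Lemma sqnorm_nabla_endoE G (D : connection M) a p
    (w : 'I_3 -> M -> 'cV[R]_(4 * n)) (W : 'I_3 -> 'rV[R]_(4 * n)) E :
    E \in unitmx ->
    (forall x y, nabla_endo D (H a) p x y =
       form_app (w (ordS (ordS a))) p x *: endo_app (H (ordS a)) p y
       - form_app (w (ordS a)) p x *: endo_app (H (ordS (ordS a))) p y) ->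
    (forall b x, form_app (w b) p x = bilin_app G p x (W b)) ->
  nabla_endo_sqnorm D G (H a) p E =
  (4 * n)%:R *
    (eps R (ordS a) * bilin_app G p (W (ordS (ordS a))) (W (ordS (ordS a)))
     + eps R (ordS (ordS a)) * bilin_app G p (W (ordS a)) (W (ordS a))).
Proof.
move=> Eu nablaJ dualW; have [Bsym _] := nhg_neutral G p.
have Bu := signature_unitmx (nhg_neutral G p).
have wE b : w b p = G p *m (W b)^T.
  apply/row_matrixP => i; apply/rowP => j; rewrite !ord1 !rowE.
  by rewrite mulmxA; exact: (dualW b).
rewrite /nabla_endo_sqnorm.
have -> : \matrix_(i, j) bilin_app G p (row i E) (row j E) = E *m G p *m E^T.
  by apply/matrixP => i j; rewrite mxE /bilin_app gram_entry.
rewrite -(sqnorm_quaternionic Bsym Bu Eu (hcJ_sqr_mx _ p) (hcJ_sqr_mx _ p)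
  (hcJ_anti_mx a p) (nhg_compat_mx G _ p) (nhg_compat_mx G _ p)
  (wE (ordS (ordS a))) (wE (ordS a))) /=.
do 4![apply: eq_bigr => ? _]; by rewrite !nablaJ.
Qed.

End QuaternionicKaehler.

Lemma ord3_cycle (a : 'I_3) :
  [\/ a = ord0, a = ordS ord0 | a = ordS (ordS ord0)].
Proof.
case: a => [[|[|[|//]]] a_lt]; [apply: Or31|apply: Or32|apply: Or33];
  exact: val_inj.
Qed.

Lemma ordS3 : ordS (ordS (ordS ord0)) = ord0 :> 'I_3.
Proof. exact: val_inj. Qed.

(** Two of the equations say that the three [q a] are equal, and the remaining
    one, whose two signs agree, that two of them are opposite. *)
Lemma eps_system (R : realType) (q : 'I_3 -> R) :
    (forall a, eps R (ordS a) * q (ordS (ordS a))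
               + eps R (ordS (ordS a)) * q (ordS a) = 0) ->
  forall a, q a = 0.
Proof.
move=> q_eq.
have := q_eq ord0; have := q_eq (ordS ord0); have := q_eq (ordS (ordS ord0)).
rewrite !ordS3.
have [-> -> ->] : [/\ eps R ord0 = 1, eps R (ordS ord0) = -1
  & eps R (ordS (ordS ord0)) = -1] by [].
move=> e2 e1 e0 a; have [->|->|->] := ord3_cycle a; lra.
Qed.

Theorem proposition2p1 (R : realType) (n : nat) (M : smooth_manifold R (4 * n))
    (H : hypercomplex M) (G : nh_metric H)
    (D : connection M) (hD : levi_civita G D)
    (L : Type) (U : L -> set M) (omega : L -> 'I_3 -> M -> 'cV[R]_(4 * n))
    (homega : quaternionic_kahler_forms H D U omega)
    (Omega : L -> 'I_3 -> M -> 'rV[R]_(4 * n))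
    (hOmega : forall (l : L) (a : 'I_3) (p : M), U l p ->
       forall x : 'rV[R]_(4 * n),
         form_app (omega l a) p x = bilin_app G p x (Omega l a p)) :
  isotropic_hyper_kahler G D <->
  (forall (l : L) (a : 'I_3) (p : M), U l p ->
     bilin_app G p (Omega l a p) (Omega l a p) = 0).
Proof.
case: homega => _ cover _ nablaJ.
have sqnormE l a p E (Ulp : U l p) (Eu : E \in unitmx) :=
  sqnorm_nabla_endoE Eu (nablaJ l a p Ulp) (fun b => hOmega l b p Ulp).
split=> [iso l a p Ulp|null a p E Eu].
- have [m0|m_neq0] := eqVneq (4 * n)%N 0%N.
    rewrite /bilin_app mxE big1 // => i _.
    by have := ltn_ord i; rewrite [X in (_ < X)%N]m0.
  move: a; apply: eps_system => a.
  have := iso a p 1%:M (unitmx1 _ _).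
  rewrite (sqnormE _ _ _ _ Ulp (unitmx1 _ _)).
  by move/eqP; rewrite mulf_eq0 pnatr_eq0 (negPf m_neq0) => /eqP.
- have [l Ulp] := cover p.
  by rewrite (sqnormE _ _ _ _ Ulp Eu) !null // !mulr0 addr0 mulr0.
Qed.
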